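(* There exists a universal constant $K\in(0,\infty)$ such that for every $\varepsilon\in(0,1)$ there exists $C_\varepsilon\in(0,\infty)$ with the following property. Let $(X,d)$ be a compact metric space and let $\mu$ be a Borel probability measure on $X$. Then there exists a compact subset $S\subseteq X$ such that: (1) $(S,d)$ embeds with distortion $K/\varepsilon$ into an ultrametric space; (2) there exists a Borel probability measure $\nu$ supported on $S$ satisfying $$\nu\left(B_d(x,r)\right)\le \left(\mu\left(B_d(x,C_\varepsilon r)\right)\right)^{1-\varepsilon}$$ for all $x\in X$ and $r\in[0,\infty)$.
   Context: An ultrametric space is a metric space $(U,\rho)$ satisfying $\rho(x,y)\le\max\{\rho(x,z),\rho(y,z)\}$ for all $x,y,z\in U$. For $D\in[1,\infty)$, a metric space $(S,d)$ embeds with distortion $D$ into an ultrametric space if there exist an ultrametric space $(U,\rho)$ and an injection $f:S\to U$ with $d(x,y)\le\rho(f(x),f(y))\le D\,d(x,y)$ for all $x,y\in S$. Closed balls are denoted $B_d(x,r)=\{y\in X:\ d(y,x)\le r\}$ for $x\in X$, $r\in[0,\infty)$. That $\nu$ is supported on $S$ means that $\nu$ is a Borel probability measure on $X$ with $\nu(S)=1$. *)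

(* Defs.v *)
From HB Require Import structures.
From mathcomp Require Import all_boot all_order all_algebra.
From mathcomp Require Import all_classical all_reals all_analysis.

Set Implicit Arguments.
Unset Strict Implicit.
Unset Printing Implicit Defensive.

Import Order.TTheory GRing.Theory Num.Theory.
Import numFieldTopology.Exports.

Local Open Scope classical_set_scope.
Local Open Scope ring_scope.

(* A measurableType carries a distinguished point, a metricType does not.
   Pointedness excludes only the empty space, which has no probability
   measure. *)
#[short(type="pointedMetricType")]
HB.structure Definition PointedMetric (K : numDomainType) :=
  { M of Metric K M & Pointed M }.

Notation borel X := (g_sigma_algebraType (@open X)).

(* Not the library's [closed_ball], which is the closure of the open ball. *)
Definition cball (R : realType) (X : metricType R) (x : X) (r : R) : set X :=
  [set y | mdist y x <= r].

Definition ultrametric (R : realType) (U : metricType R) : Prop :=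
  forall x y z : U, mdist x y <= Num.max (mdist x z) (mdist y z).

(* The embedding is the restriction to [S] of [f : X -> U]. *)
Definition embeds_ultrametric (R : realType) (X : metricType R) (S : set X)
    (D : R) : Prop :=
  1 <= D /\
  exists (U : metricType R) (f : X -> U),
    [/\ ultrametric U,
        {in S &, injective f} &
        {in S &, forall x y,
          mdist x y <= mdist (f x) (f y) <= D * mdist x y}].

(* Main.v *)
Require Import Defs.
From HB Require Import structures.
From mathcomp Require Import all_boot all_order all_algebra.
From mathcomp Require Import all_classical all_reals all_analysis.
From mathcomp Require Import ring lra.

Set Implicit Arguments.
Unset Strict Implicit.
Unset Printing Implicit Defensive.

Import Order.TTheory GRing.Theory Num.Theory.
Import numFieldTopology.Exports.

Local Open Scope classical_set_scope.
Local Open Scope ring_scope.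

(**
A nested tree of closed cells of diameter at most [Delta / 4 ^ k] is built, in
which the children of a cell [G] at scale [D] are carved one after the other:
in the remaining region take the heaviest ball of radius [D / 16] and let its
radius grow to [D / 8] in [t >= 1 / eps] equal steps. On one of these steps the
mass grows by a factor at most [(M / m) ^ eps], where [m] and [M] are the
masses of the first and of the last ball. The ball before that step is the new
cell [K], the ball after it is the zone [Z], and [Z] is removed from the
region; hence cells of one level are [D / (16 t)]-separated, which makes the
intersection of the levels an ultrametric with distortion [16 t].

The measure [nu] gives [K] the share of [nu G] that [Z] has in the mass of [G].
The invariant is [nu G * theta ^ eps <= mu G], with [theta] the mass of the
heaviest ball of radius [D / 8] in [G]: the choice of the heaviest ball and the
slow growth propagate it to [K]. Since [Z] lies in such a ball, it also gives
[nu K <= (mu Z) ^ (1 - eps)]. This compares [nu K] with the zone around [K],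
not with [K] itself, so it does not matter how fast the masses of balls decay
as the radius shrinks.
*)

(** * Metric preliminaries *)

Lemma cball_closed (R : realType) (X : metricType R) (x : X) (r : R) :
  closed (cball x r).
Proof.
rewrite -[cball x r]setCK; apply: open_closedC; rewrite openE => y /= /negP.
rewrite -ltNge => ry; apply/nbhs_ballP; exists (mdist y x - r) => /=.
  by rewrite subr_gt0.
move=> z; rewrite ballEmdist /= => yz; apply/negP; rewrite -ltNge.
have := metric_triangle y z x; lra.
Qed.

Lemma open_mdist_lt (R : realType) (X : metricType R) (x : X) (r : R) :
  open [set y | mdist y x < r].
Proof.
rewrite openE => y /= yr; apply/nbhs_ballP; exists (r - mdist y x) => /=.
  by rewrite subr_gt0.
move=> z; rewrite ballEmdist /= => yz.
have := metric_triangle z y x; rewrite (metric_sym z y); lra.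
Qed.

Lemma compact_net (R : realType) (X : pointedMetricType R) (e : R) :
  compact [set: X] -> 0 < e -> exists s : seq X,
    forall x, exists2 z, z \in s & mdist x z < e.
Proof.
move=> cX e0; move: cX; rewrite compact_cover => cX.
have [|x _|D _ Dc] := cX X setT (fun z => [set y | mdist y z < e]).
- by move=> z _; exact: open_mdist_lt.
- by exists x => //=; rewrite mdistxx.
- exists (finmap.enum_fset D) => x; have [z zD xz] := Dc x I.
  by exists z.
Qed.

Lemma exists_max_seq (R : realType) (T : eqType) (s : seq T) (f : T -> R) :
  s != [::] -> exists2 z, z \in s & forall y, y \in s -> f y <= f z.
Proof.
elim: s => // x s IH _; have [->|/IH[z zs zm]] := eqVneq s [::].
  by exists x; rewrite ?inE // => y; rewrite inE => /eqP ->.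
have [xz|zx] := leP (f x) (f z).
- exists z; first by rewrite inE zs orbT.
  by move=> y; rewrite inE => /predU1P[->//|/zm].
- exists x; first by rewrite inE eqxx.
  move=> y; rewrite inE => /predU1P[->//|/zm yz].
  exact: le_trans yz (ltW zx).
Qed.

(** Otherwise [f t] would exceed [f 0 * (f t / f 0) ^ (eps * t) >= f t]. *)
Lemma exists_slow_growth (R : realType) (f : nat -> R) (t : nat) (eps : R) :
  0 < eps -> 1 <= eps * t%:R -> 0 < f 0%N -> f 0%N <= f t ->
  exists2 i, (i < t)%N & f i.+1 <= f i * (f t / f 0%N) `^ eps.
Proof.
move=> e0 et f0 f0t; apply: contrapT => H.
set c := (f t / f 0%N) `^ eps.
have q1 : 1 <= f t / f 0%N by rewrite ler_pdivlMr ?mul1r.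
have c0 : 0 < c by rewrite powR_gt0 ?(lt_le_trans ltr01).
have step i : (i < t)%N -> f i * c < f i.+1.
  by move=> it; rewrite ltNge; apply/negP => le; apply: H; exists i.
have t0 : (0 < t)%N.
  by case: t et {f0t c q1 c0 step H} => //; rewrite mulr0 ler10.
have grow i : (i < t)%N -> f 0%N * c ^+ i.+1 < f i.+1.
  elim: i => [|i IH] it; first by rewrite expr1 step.
  apply: lt_trans (step _ it); rewrite exprSr mulrA ltr_pM2r //.
  exact: IH (ltnW it).
have := grow t.-1; rewrite prednK // => /(_ (leqnn _)).
rewrite -powR_mulrn ?(ltW c0) // -powRrM ltNge => /negP; apply.
rewrite -[leLHS](divfK (lt0r_neq0 f0)) mulrC ler_pM2l //.
by rewrite -[leLHS]powRr1 ?(le_trans ler01) // ler_powR.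
Qed.

Lemma exists_geometric_lt (R : realType) (D e : R) :
  0 < e -> exists n, D / 4 ^+ n < e.
Proof.
move=> e0; have [D0|D0] := leP D 0.
  by exists 0%N; rewrite expr0 divr1 (le_lt_trans D0).
exists (Num.bound (D / e)); rewrite ltr_pdivrMr ?exprn_gt0 //.
rewrite -ltr_pdivrMl // mulrC.
apply: lt_trans (archi_boundP _) _; first by rewrite divr_ge0 ?ltW.
by rewrite -natrX ltr_nat ltn_expl.
Qed.

(** The sets [A n] form a base of a proper filter. By compactness it has a cluster point, which lies
    in the closure of each [A n]. *)
Lemma nested_closed_nonempty (T : topologicalType) (A : nat -> set T) :
  compact [set: T] -> (forall n, closed (A n)) -> (forall n, A n !=set0) ->
  (forall n, A n.+1 `<=` A n) -> exists x, forall n, A n x.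
Proof.
move=> cT Acl A0 Adec.
have Amono m n : (m <= n)%N -> A n `<=` A m.
  move=> /subnK <-; elim: (n - m)%N => // k IH.
  by rewrite addSn; apply: subset_trans IH.
pose F := filter_from [set: nat] A.
have FF : ProperFilter F.
  apply: filter_from_proper => [|n _]; last exact: A0.
  apply: filter_from_filter; first by exists 0%N.
  move=> i j _ _; exists (maxn i j) => // x Ax.
  by split; apply: Amono Ax; rewrite ?leq_maxl ?leq_maxr.
have [x [_ xF]] := cT F FF (filterT (F := F)).
exists x => n; apply: (Acl n); move=> B xB; apply: xF => //.
by exists n.
Qed.

(** * Ultrametrics from nested equivalence relations *)

Section metric_of_distance.
Context {R : realType} {T : Type}.

Definition is_distance (rho : T -> T -> R) : Prop :=
  [/\ forall x, rho x x = 0, forall x y, rho x y = 0 -> x = y,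
      forall x y, rho x y = rho y x &
      forall y x z, rho x z <= rho x y + rho y z].

(** The proof is an argument of the alias because the instances below must recover the axioms of
    [rho] from the type alone. *)
Definition metric_carrier (rho : T -> T -> R) of is_distance rho : Type := T.

Variables (rho : T -> T -> R) (rhoP : is_distance rho).
Local Notation M := (metric_carrier rhoP).

Let rhoxx (x : M) : rho x x = 0. Proof. by have [] := rhoP. Qed.
Let rho_pos (x y : M) : rho x y = 0 -> x = y. 
Proof. by have [_ rho_pos _ _] := rhoP; exact: rho_pos. Qed.
Let rho_sym (x y : M) : rho x y = rho y x. Proof. by have [] := rhoP. Qed.
Let rho_triangle (y x z : M) : rho x z <= rho x y + rho y z.
Proof. by have [] := rhoP. Qed.

HB.instance Definition _ := gen_eqMixin M.
HB.instance Definition _ := gen_choiceMixin M.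
HB.instance Definition _ :=
  isMetric.Build R M rhoxx rho_pos rho_sym rho_triangle.

Lemma mdist_carrierE (x y : M) : mdist x y = rho x y.
Proof. by []. Qed.

End metric_of_distance.

Section ultrametric_of_tree.
Variables (R : realType) (T : Type) (D : nat -> R).
Variable E : nat -> T -> T -> Prop.
Hypothesis D_gt0 : forall k, 0 < D k.
Hypothesis D_mono : forall i j, (i <= j)%N -> D j <= D i.
Hypothesis D_cvg0 : forall e, 0 < e -> exists k, D k < e.
Hypothesis E0 : forall x y, E 0%N x y.
Hypothesis Exx : forall k x, E k x x.
Hypothesis E_sym : forall k x y, E k x y -> E k y x.
Hypothesis E_trans : forall k x y z, E k x y -> E k y z -> E k x z.
Hypothesis E_anti : forall k x y, E k.+1 x y -> E k x y.
Hypothesis E_separates : forall x y, (forall k, E k x y) -> x = y.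

(** For distinct points this is the scale of the last level that joins them. The infimum also gives
    0 on the diagonal, where every level does. *)
Let rho x y := inf [set D k | k in [set k | E k x y]].

Let E_mono i j x y : (i <= j)%N -> E j x y -> E i x y.
Proof.
move=> /subnK <-; elim: (j - i)%N => // k IH.
by rewrite addSn => /E_anti.
Qed.

Let rho_le k x y : E k x y -> rho x y <= D k.
Proof.
move=> kxy; apply: ge_inf; last by exists k.
by exists 0 => _ [j _ <-]; exact: ltW.
Qed.

Let rho_ge k x y : ~ E k.+1 x y -> D k <= rho x y.
Proof.
move=> kxy; apply: lb_le_inf; first by exists (D 0%N), 0%N => //=; exact: E0.
move=> _ [j jxy <-]; apply: D_mono; rewrite leqNgt; apply/negP => kj.
exact/kxy/(E_mono kj).
Qed.

(** Without a last common level, induction from [E0] would relate the points at every level, against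
    [E_separates]. *)
Let rho_split x y : x <> y ->
  exists k, [/\ E k x y, ~ E k.+1 x y & rho x y = D k].
Proof.
move=> xy; have [k kxy] : exists k, E k x y /\ ~ E k.+1 x y.
  apply: contrapT => H; apply: xy; apply: E_separates.
  elim=> [|k IH]; first exact: E0.
  by apply: contrapT => nE; apply: H; exists k.
case: kxy => kxy nkxy; exists k; split => //.
by apply/eqP; rewrite eq_le rho_le // rho_ge.
Qed.

Let rhoxx x : rho x x = 0.
Proof.
apply/eqP; rewrite eq_le; apply/andP; split.
  apply/ler_addgt0Pl => e /D_cvg0[k ke]; rewrite addr0.
  exact: le_trans (rho_le (Exx k x)) (ltW ke).
apply: lb_le_inf; first by exists (D 0%N), 0%N => //=; exact: E0.
by move=> _ [j _ <-]; exact: ltW.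
Qed.

Let rho_ge0 x y : 0 <= rho x y.
Proof.
have [->|/rho_split[k [_ _ ->]]] := pselect (x = y); first by rewrite rhoxx.
exact: ltW.
Qed.

Let rho_pos x y : rho x y = 0 -> x = y.
Proof.
move=> xy0; apply: contrapT => /rho_split[k [_ _]]; rewrite xy0 => D0.
by have := D_gt0 k; rewrite -D0 ltxx.
Qed.

Let rho_sym x y : rho x y = rho y x.
Proof.
congr (inf (image _ D)); apply/seteqP.
by split => k /=; exact: E_sym.
Qed.

Let rho_ultra y x z : rho x z <= Num.max (rho x y) (rho y z).
Proof.
have [->|/rho_split[k [_ nE ->]]] := pselect (x = z).
  by rewrite rhoxx le_max rho_ge0.
(* At the level [k.+1], which separates [x] from [z], transitivity separates [y] from one of
   them. *)
rewrite le_max; have [kxy|nkxy] := pselect (E k.+1 x y).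
  rewrite (@rho_ge k y z) ?orbT // => kyz; apply: nE.
  exact: E_trans kxy kyz.
by rewrite rho_ge.
Qed.

Let rho_triangle y x z : rho x z <= rho x y + rho y z.
Proof.
apply: le_trans (rho_ultra y x z) _.
by rewrite ge_max lerDl lerDr !rho_ge0.
Qed.

(** The exact value [D k], given with the level where the points part, lets both distortion bounds
    be read off from the diameters and gaps of the cells. *)
Lemma exists_ultrametric_of_tree :
  exists (U : metricType R) (f : T -> U),
    [/\ ultrametric U, injective f &
        forall x y, x <> y -> exists k,
          [/\ E k x y, ~ E k.+1 x y & mdist (f x) (f y) = D k]].
Proof.
have rhoP : is_distance rho by split.
exists (metric_carrier rhoP), id; split; [|by []|].
- by move=> x y z; rewrite !mdist_carrierE (rho_sym y z); exact: rho_ultra.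
- exact: rho_split.
Qed.

End ultrametric_of_tree.

(** * Carving separated cells *)

Section mass.
Context {R : realType} {X : pointedMetricType R}.
Variable mu : probability (borel X) R.
Implicit Types A B : set X.

Local Notation meas A := (measurable (A : set (borel X))).

Definition mass A : R := fine (mu A).

Lemma open_borel A : open A -> meas A.
Proof. by move=> oA; exact: sub_sigma_algebra. Qed.

Lemma closed_borel A : closed A -> meas A.
Proof.
move=> cA; rewrite -[A]setCK; apply: measurableC.
by apply: open_borel; exact: closed_openC.
Qed.

Lemma cball_borel (x : X) (r : R) : meas (cball x r).
Proof. by apply: closed_borel; exact: cball_closed. Qed.

Lemma massE A : meas A -> mu A = (mass A)%:E.
Proof. by move=> mA; rewrite fineK // fin_num_measure. Qed.

Lemma mass_ge0 A : 0 <= mass A.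
Proof. exact: fine_ge0. Qed.

Lemma massT : mass [set: X] = 1.
Proof. by rewrite /mass probability_setT. Qed.

Lemma mass_le A B : meas A -> meas B -> A `<=` B -> mass A <= mass B.
Proof.
move=> mA mB AB; rewrite -lee_fin -(massE mA) -(massE mB).
by apply: le_measure => //; rewrite inE.
Qed.

Lemma mass_le1 A : meas A -> mass A <= 1.
Proof. by move=> mA; rewrite -lee_fin -massE // probability_le1. Qed.

Lemma mass_split A B : meas A -> meas B ->
  mass A = mass (B `&` A) + mass (A `\` B).
Proof.
move=> mA mB; apply: EFin_inj; rewrite EFinD -!massE //.
- by rewrite setIC addeC -measureDI.
- exact: measurableD.
- exact: measurableI.
Qed.

(** A net ball that meets [A] in a null set can be removed from [A] without loss, and the other
    centres still cover the rest. An exhausted net would leave [A] empty. *)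
Lemma exists_mass_gt0 (s : seq X) (r : R) A : meas A ->
  (forall x, A x -> exists2 z, z \in s & mdist x z < r) -> 0 < mass A ->
  exists2 z, z \in s & 0 < mass (cball z r `&` A).
Proof.
elim: s A => [|z s IH] A mA sA A0.
  have A_empty : A = set0.
    by apply/seteqP; split => // x /sA[].
  by move: A0; rewrite A_empty /mass measure0 ltxx.
have mB : meas (cball z r) by exact: cball_borel.
have [z0|] := ltP 0 (mass (cball z r `&` A)).
  by exists z; rewrite ?mem_head.
move=> z_le0; have mAB : meas (A `\` cball z r) by exact: measurableD.
have [|||y ys y0] := IH (A `\` cball z r) => //.
- move=> x [/sA[y]]; rewrite inE => /predU1P[-> xz /negP|ys xy _].
    by rewrite ltW.
  by exists y.
- by move: A0; rewrite (mass_split mA mB); lra.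
- exists y; first by rewrite inE ys orbT.
  have mBy : meas (cball y r) by exact: cball_borel.
  apply: lt_le_trans y0 _; apply: mass_le; [exact: measurableI..|].
  by apply: setIS; exact: subDsetl.
Qed.

End mass.

(** Strict decrease of the count on which the carving of a region terminates. *)
Lemma count_predD1_lt (T : eqType) (p : pred T) (z : T) (s : seq T) :
  z \in s -> p z -> (count (predD1 p z) s < count p s)%N.
Proof.
move=> zs pz; have := count_predUI (predD1 p z) (pred1 z) s.
have -> : count (predI (predD1 p z) (pred1 z)) s = 0%N.
  rewrite -(count_pred0 s); apply: eq_count => y /=.
  by case: (y == z); rewrite /= ?andbF.
rewrite addn0 (@eq_count _ (predU _ _) p) => [->|y /=]; last first.
  by have [->|] := eqVneq y z; rewrite ?pz ?orbF.
by rewrite -addn1 leq_add2l -has_count has_pred1.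
Qed.

(** The interval [slot_lo, slot_hi[ of [0, 1[ encodes the measure of the cell:
    the measure of the theorem is the image of the uniform one. *)
Record node (R : realType) (X : Type) := Node {
  cell : set X;
  slot_lo : R;
  slot_hi : R
}.
Arguments Node {R X}.

HB.instance Definition _ (R : realType) (X : Type) := gen_eqMixin (node R X).
HB.instance Definition _ (R : realType) (X : Type) :=
  gen_choiceMixin (node R X).

Definition slot (R : realType) (X : Type) (s : node R X) : set R :=
  `[slot_lo s, slot_hi s[%classic.

Definition weight (R : realType) (X : Type) (s : node R X) : R :=
  slot_hi s - slot_lo s.

Definition separated (R : realType) (X : metricType R) (e : R) (A B : set X) :=
  forall x y, A x -> B y -> e <= mdist x y.

(** * One refinement step *)

Section refinement.
Context {R : realType} {X : pointedMetricType R}.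
Variables (mu : probability (borel X) R) (eps : R) (t : nat).
Hypothesis eps01 : 0 < eps < 1.
Hypothesis eps_t : 1 <= eps * t%:R.
Hypothesis cX : compact [set: X].

Local Notation mass := (mass mu).
Local Notation meas A := (measurable (A : set (borel X))).

(** [D / 8] is the largest radius that a ball may reach while [s] is carved at scale [D]. *)
Definition admissible (D : R) (s : node R X) := [/\ closed (cell s),
  0 < mass (cell s), 0 < weight s &
  forall z,
    weight s * mass (cball z (D / 8) `&` cell s) `^ eps <= mass (cell s)].

(** Here [D] is the scale of the parent of [s]. *)
Definition capped (D : R) (s : node R X) := forall x, cell s x ->
  weight s <= mass (cball x (D / 4)) `^ (1 - eps).

Definition thin (D : R) (s : node R X) :=
  forall x y, cell s x -> cell s y -> mdist x y <= D / 4.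

Lemma mul_powR_le (a b x y : R) : 0 <= a -> 0 <= x -> x <= y ->
  a * y `^ eps <= b -> a * x `^ eps <= b.
Proof.
have [e0 _] := andP eps01; move=> a0 x0 xy; apply: le_trans.
apply: ler_wpM2l => //; apply: ge0_ler_powR; rewrite ?nnegrE ?(ltW e0) //.
exact: le_trans xy.
Qed.

Let delta (D : R) := D / (16 * t%:R).
Let rad (D : R) (i : nat) := D / 16 + i%:R * delta D.

Let t_gt0 : 0 < t%:R :> R.
Proof. by rewrite ltr0n; case: t eps_t => //; rewrite mulr0 ler10. Qed.

Let delta_gt0 D : 0 < D -> 0 < delta D.
Proof. by move=> D0; rewrite divr_gt0 // mulr_gt0. Qed.

Let rad_t D : rad D t = D / 8.
Proof. by rewrite /rad /delta; field; exact: lt0r_neq0. Qed.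

Let rad_le D i : 0 < D -> (i <= t)%N -> rad D i <= D / 8.
Proof.
move=> D0 it; rewrite -rad_t lerD2l ler_pM2r ?ler_nat //.
exact: delta_gt0.
Qed.

Let radS D i : rad D i.+1 = rad D i + delta D.
Proof. by rewrite /rad -natr1; ring. Qed.

Let rad0 D : rad D 0 = D / 16.
Proof. by rewrite /rad mul0r addr0. Qed.

(** The child is tested on balls of radius [D / 4 / 8 = D / 32]. With a net this fine, each lies in
    a ball of radius [D / 16] about a net point, so the heaviest ball need only be sought among net
    points. The slot length is proportional to the mass of [Z], not of the cell, so that successive
    slots use up the whole slot of the parent. *)
Lemma carve_core (D : R) (s : node R X) (net : seq X) (Rg : set X) (a : R) :
  0 < D -> admissible D s -> closed Rg -> Rg `<=` cell s -> 0 < mass Rg ->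
  (forall x, exists2 z, z \in net & mdist x z < D / 32) ->
  exists (z : X) (Z : set X) (s' : node R X),
    [/\ [/\ z \in net, 0 < mass (cball z (D / 16) `&` Rg),
            cball z (D / 16) `&` Rg `<=` Z, Z `<=` Rg & meas Z],
        [/\ closed (Rg `\` Z), cell s' `<=` Rg,
            separated (delta D) (cell s') (Rg `\` Z) &
            slot_lo s' = a /\
            slot_hi s' = a + weight s / mass (cell s) * mass Z],
        admissible (D / 4) s', capped D s' & thin D s'].
Proof.
move=> D0 [Gcl G0 p0 Gp] Rcl RG R0 net_cov.
have mR : meas Rg by exact: closed_borel.
have mG : meas (cell s) by exact: closed_borel.
have mB x r : meas (cball x r `&` Rg).
  by apply: measurableI => //; exact: cball_borel.
have [e0 e1] := andP eps01.
pose f z i := mass (cball z (rad D i) `&` Rg).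
have net_cov16 x : Rg x -> exists2 z, z \in net & mdist x z < D / 16.
  by move=> _; have [z zn xz] := net_cov x; exists z => //; lra.
have [z1 z1n z10] := exists_mass_gt0 mR net_cov16 R0.
have [|z zn zmax] := @exists_max_seq R X net (fun y => f y 0%N).
  by apply/eqP => net0; rewrite net0 in z1n.
have f_mono i j : (i <= j)%N -> f z i <= f z j.
  move=> ij; apply: mass_le => //; apply: setSI => y /= /le_trans; apply.
  by rewrite lerD2l ler_pM2r ?ler_nat // delta_gt0.
have fz0 : 0 < f z 0%N.
  by apply: lt_le_trans (zmax _ z1n); rewrite /f rad0.
have [i it fi] := exists_slow_growth e0 eps_t fz0 (f_mono _ _ (leq0n t)).
(* The zone comes from an open ball, so that the rest of [Rg] is closed. The cell comes from the
   closed ball one step smaller, which leaves the gap [delta D]. *)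
pose O := [set y | mdist y z < rad D i.+1].
have oO : open O by exact: open_mdist_lt.
have mZ : meas (O `&` Rg) by apply: measurableI => //; exact: open_borel.
have radlt : rad D i < rad D i.+1 by rewrite radS ltrDl delta_gt0.
have Zf : mass (O `&` Rg) <= f z i.+1.
  by apply: mass_le => //; apply: setSI => y /ltW.
have fZ : f z i <= mass (O `&` Rg).
  by apply: mass_le => //; apply: setSI => y yi; exact: le_lt_trans yi radlt.
have fzi : 0 < f z i by exact: lt_le_trans fz0 (f_mono _ _ (leq0n i)).
have Z0 : 0 < mass (O `&` Rg) by exact: lt_le_trans fzi fZ.
pose c := weight s / mass (cell s).
have c0 : 0 < c by exact: divr_gt0.
pose s' := Node (cball z (rad D i) `&` Rg) a (a + c * mass (O `&` Rg)).
have K_rad x : cell s' x -> mdist x z <= rad D i by case.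
have ws' : weight s' = c * mass (O `&` Rg) by rewrite /weight /= addrC addKr.
(* The invariant of the parent, for the ball of radius [rad D t = D / 8]. *)
have cM : c * f z t `^ eps <= 1.
  rewrite mulrAC ler_pdivrMr // mul1r.
  apply: (mul_powR_le _ _ _ (Gp z)); [exact: ltW|exact: mass_ge0|].
  apply: mass_le => //; first by apply: measurableI => //; exact: cball_borel.
  by rewrite rad_t; exact: setIS.
have fzt : 0 < f z t by exact: lt_le_trans fz0 (f_mono _ _ (leq0n t)).
exists z, (O `&` Rg), s'; split; [split|split| | |] => //=.
- by rewrite -(rad0 D).
- apply: setSI => y /= yz; apply: le_lt_trans yz _.
  rewrite -rad0; apply: le_lt_trans radlt.
  by rewrite lerD2l ler_pM2r ?ler_nat ?delta_gt0.
- rewrite setDE setCI setIUr setICr setU0; apply: closedI => //.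
  exact: open_closedC.
- move=> x y /K_rad xz [Ry Oy].
  have : rad D i.+1 <= mdist y z by rewrite leNgt; apply/negP => yO; exact: Oy.
  by have := metric_triangle y x z; rewrite (metric_sym y x) radS; lra.
- split => //=.
  + by apply: closedI => //; exact: cball_closed.
  + by rewrite ws' mulr_gt0.
  + move=> y; rewrite ws'.
    have [z' z'n yz'] := net_cov y.
    have y_le :
        mass (cball y (D / 4 / 8) `&` (cball z (rad D i) `&` Rg)) <= f z 0%N.
      apply: le_trans (zmax _ z'n); apply: mass_le => //.
        by apply: measurableI => //; exact: cball_borel.
      rewrite /cball => x [/= xy [_ Rx]]; split => //=; rewrite rad0.
      by have := metric_triangle x y z'; lra.
    apply: (@mul_powR_le _ _ _ (f z 0%N)) => //.
    * by rewrite mulr_ge0 ?ltW.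
    * exact: mass_ge0.
    (* Slow growth bounds the mass of the zone by [f z i] times the growth factor. The powers of
       [f z 0] then cancel and leave [f z i] times the quantity bounded by [cM]. *)
    apply: (@le_trans _ _
      (c * (f z i * (f z t / f z 0%N) `^ eps) * f z 0%N `^ eps)).
      rewrite ler_pM2r ?powR_gt0 // ler_pM2l //.
      exact: le_trans Zf fi.
    have -> : c * (f z i * (f z t / f z 0%N) `^ eps) * f z 0%N `^ eps
        = f z i * (c * ((f z t / f z 0%N) `^ eps * f z 0%N `^ eps)) by ring.
    rewrite -powRM ?mass_ge0 ?divr_ge0 ?mass_ge0 // divfK ?gt_eqF //.
    by rewrite -[leRHS]/(f z i) ger_pMr.
- move=> x /K_rad xz; rewrite ws'.
  have Zx : mass (O `&` Rg) <= mass (cball x (D / 4)).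
    apply: mass_le => //; first exact: cball_borel.
    rewrite /O /cball => y [/= yz _].
    have := metric_triangle y z x; rewrite (metric_sym z x).
    by have := rad_le D0 it; have := rad_le D0 (ltnW it); lra.
  apply: le_trans (_ : mass (O `&` Rg) `^ (1 - eps) <= _); last first.
    by apply: ge0_ler_powR => //; rewrite ?nnegrE ?mass_ge0 // subr_ge0 ltW.
  (* The factor of exponent [eps] is absorbed by [cM], since the zone has mass at most [f z t]. *)
  have ZE : mass (O `&` Rg) =
      mass (O `&` Rg) `^ eps * mass (O `&` Rg) `^ (1 - eps).
    rewrite -powRD; last by rewrite (gt_eqF Z0) implybT.
    by rewrite addrC subrK powRr1 // ltW.
  rewrite [in leLHS]ZE mulrA ger_pMl ?powR_gt0 //.
  apply: (mul_powR_le _ _ _ cM); [exact: ltW|exact: ltW|].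
  exact: le_trans Zf (f_mono _ _ it).
- move=> x y /K_rad xz /K_rad yz; have := metric_triangle x z y.
  by rewrite (metric_sym z y); have := rad_le D0 (ltnW it); lra.
Qed.

Lemma slot_ge_lo (s : node R X) u : slot s u -> slot_lo s <= u.
Proof. by rewrite /slot /= in_itv /= => /andP[]. Qed.

Lemma slot_lt_hi (s : node R X) u : slot s u -> u < slot_hi s.
Proof. by rewrite /slot /= in_itv /= => /andP[]. Qed.

(** The slots fill [[a, b[] although the cells need not cover [Rg]: the share of a whole zone goes
    to the cell inside it. *)
Definition refines (D a b : R) (Rg : set X) (C : set (node R X)) :=
  [/\ finite_set C,
      forall s, C s -> [/\ admissible (D / 4) s, capped D s, thin D s,
        cell s `<=` Rg & slot s `<=` `[a, b[],
      `[a, b[ `<=` \bigcup_(s in C) slot s,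
      forall s s' u, C s -> C s' -> slot s u -> slot s' u -> s = s' &
      forall s s', C s -> C s' -> s <> s' ->
        separated (delta D) (cell s) (cell s')].

(** Induction on the number of net points whose ball of radius [D / 16] meets the region in positive
    mass. Carving about [z] removes that ball from the region, so [z] is no longer counted. *)
Lemma refine_region (D : R) (s : node R X) (net : seq X) (n : nat) Rg a :
  0 < D -> admissible D s -> closed Rg -> Rg `<=` cell s ->
  (forall x, exists2 z, z \in net & mdist x z < D / 32) ->
  (count (fun z => 0 < mass (cball z (D / 16) `&` Rg))%R net < n)%N ->
  exists C, refines D a (a + weight s / mass (cell s) * mass Rg) Rg C.
Proof.
move=> D0 sadm; have [_ G0 w0 _] := sadm.
set c := weight s / mass (cell s); have c0 : 0 < c by exact: divr_gt0.
elim: n Rg a => // n IH Rg a Rcl RG net_cov Rn.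
have [R0|R_le0] := ltP 0 (mass Rg); last first.
  have -> : mass Rg = 0 by apply/eqP; rewrite eq_le R_le0 mass_ge0.
  (* For a null region the interval to be filled is empty. *)
  exists set0; split => //; rewrite mulr0 addr0 => u.
  by rewrite /= in_itv /=; lra.
have [z [Z [s' [[zn z0 zZ ZR mZ] [Rcl' s'R sep [lo hi]]
    s'adm s'cap s'thin]]]] :=
  carve_core a D0 sadm Rcl RG R0 net_cov.
rewrite -/c in hi.
have mR : meas Rg by exact: closed_borel.
have mR' : meas (Rg `\` Z) by exact: measurableD.
have mB x r : meas (cball x r) by exact: cball_borel.
have massR : mass Rg = mass Z + mass (Rg `\` Z).
  by rewrite (mass_split mu mR mZ) setIidl.
have [| |C [Cfin Cprop Ccov Cdisj Csep]] :=
    IH (Rg `\` Z) (slot_hi s') Rcl' _ net_cov.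
- exact: subset_trans (@subDsetl _ _ _) RG.
- rewrite -ltnS; apply: leq_trans Rn; rewrite ltnS.
  apply: (@leq_ltn_trans (count
    (predD1 (fun y => 0 < mass (cball y (D / 16) `&` Rg))%R z) net)).
    apply: sub_count => y /= y0; apply/andP; split.
      apply: contraTneq y0 => ->; rewrite -leNgt.
      rewrite (_ : _ `&` _ = set0) /mass ?measure0 //.
      by apply/seteqP; split => // x [xz [xR]]; apply; apply: zZ.
    apply: lt_le_trans y0 _; apply: mass_le; [exact: measurableI..|].
    by apply: setIS; exact: subDsetl.
  exact: count_predD1_lt.
have hiE : slot_hi s' + c * mass (Rg `\` Z) = a + c * mass Rg.
  by rewrite hi massR; ring.
have hi_ge : a <= slot_hi s' by rewrite hi lerDl mulr_ge0 ?mass_ge0 ?ltW.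
have hi_le : slot_hi s' <= a + c * mass Rg.
  by rewrite -hiE lerDl mulr_ge0 ?mass_ge0 ?ltW.
rewrite hiE in Cprop Ccov; clearbody c.
have C_hi s1 u : C s1 -> slot s1 u -> slot_hi s' <= u.
  by case/Cprop => _ _ _ _ s1sub /s1sub; rewrite /= in_itv /= => /andP[].
have C_R s1 : C s1 -> cell s1 `<=` Rg `\` Z by case/Cprop.
exists (s' |` C); split.
- by rewrite finite_setU; split.
- move=> s1 [->|/Cprop[adm cap th sub itv]]; split => //.
  + move=> u us; rewrite /= in_itv /=.
    by have := slot_ge_lo us; have := slot_lt_hi us; rewrite lo; lra.
  + by apply: subset_trans sub _; exact: subDsetl.
  + by move=> u /itv; rewrite /= !in_itv /=; lra.
- move=> u; rewrite /= in_itv /= => /andP[au ub].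
  have [us'|us'] := ltP u (slot_hi s').
    by exists s'; [left|rewrite /slot /= in_itv /= lo au us'].
  have [|s1 Cs1 us1] := Ccov u; first by rewrite /= in_itv /= us' ub.
  by exists s1; [right|].
- move=> s1 s2 u [->|C1] [->|C2] // u1 u2.
  + by exfalso; have := C_hi _ _ C2 u2; have := slot_lt_hi u1; lra.
  + by exfalso; have := C_hi _ _ C1 u1; have := slot_lt_hi u2; lra.
  + exact: Cdisj u1 u2.
- move=> s1 s2 [->|C1] [->|C2] // s12 x y x1 y2.
  + by apply: sep => //; exact: C_R y2.
  + by rewrite metric_sym; apply: sep => //; exact: C_R x1.
  + exact: Csep x1 y2.
Qed.

Lemma refine_node (D : R) (s : node R X) : 0 < D -> admissible D s ->
  exists C, refines D (slot_lo s) (slot_hi s) (cell s) C.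
Proof.
move=> D0 sadm; have [Gcl G0 _ _] := sadm.
have D32 : 0 < D / 32 by exact: divr_gt0.
have [net net_cov] := compact_net cX D32.
have [C] := refine_region (slot_lo s) D0 sadm Gcl (@subset_refl _ _) net_cov
  (leqnn _).
by rewrite divfK ?gt_eqF // addrC subrK; exists C.
Qed.

End refinement.

(** * The tree of cells *)

Section tree.
Context {R : realType} {X : pointedMetricType R}.
Variables (mu : probability (borel X) R) (eps : R) (t : nat).
Hypothesis eps01 : 0 < eps < 1.
Hypothesis eps_t : 1 <= eps * t%:R.
Hypothesis cX : compact [set: X].
Variable Delta : R.
Hypothesis Delta_gt0 : 0 < Delta.

Definition scale k : R := Delta / 4 ^+ k.

Lemma scale_gt0 k : 0 < scale k.
Proof. by rewrite divr_gt0 // exprn_gt0. Qed.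

Lemma scaleS k : scale k.+1 = scale k / 4.
Proof. by rewrite /scale exprSr invfM mulrA. Qed.

Lemma scale_mono i j : (i <= j)%N -> scale j <= scale i.
Proof.
move=> ij; rewrite /scale ler_pM2l // lef_pV2 ?posrE ?exprn_gt0 //.
by rewrite ler_weXn2l // ler1n.
Qed.

(** This is [delta (scale k)], the separation of the children of a cell of level [k]; it therefore
    concerns cells of level [k.+1]. *)
Definition gap k : R := scale k / (16 * t%:R).

Lemma gap_mono i j : (i <= j)%N -> gap j <= gap i.
Proof.
move=> ij; rewrite ler_wpM2r ?scale_mono // invr_ge0 mulr_ge0 //.
Qed.

Lemma t_gt0 : 0 < t%:R :> R.
Proof. by rewrite ltr0n; case: t eps_t => //; rewrite mulr0 ler10. Qed.

Lemma gap_gt0 k : 0 < gap k.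
Proof. by rewrite divr_gt0 ?scale_gt0 // mulr_gt0 // t_gt0. Qed.

Definition root : node R X := Node setT 0 1.

Local Notation itv01 := (`[0, 1[%classic : set R).
Local Notation admissible := (admissible mu eps).
Local Notation capped := (capped mu eps).

Lemma root_admissible D : admissible D root.
Proof.
have [e0 _] := andP eps01; split.
- exact: closedT.
- by rewrite /= massT.
- by rewrite /weight /= subr0.
move=> z; rewrite /weight /= subr0 mul1r massT setIT.
apply: (@le_trans _ _ (1 `^ eps)); last by rewrite powR1.
apply: ge0_ler_powR; rewrite ?nnegrE ?(ltW e0) ?mass_ge0 //.
by apply: mass_le1; exact: cball_borel.
Qed.

(** The tree is coded by its branches: [N k u] is the node of level [k] whose slot contains [u]. *)
Definition branching (N : nat -> R -> node R X) : Prop :=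
  [/\ forall u, N 0%N u = root,
      forall k u, itv01 u -> admissible (scale k) (N k u) /\ slot (N k u) u,
      forall k u, itv01 u -> [/\ capped (scale k) (N k.+1 u),
        thin (scale k) (N k.+1 u) & cell (N k.+1 u) `<=` cell (N k u)],
      forall k u v, itv01 u -> itv01 v -> slot (N k u) v -> N k v = N k u &
      (forall k u v, itv01 u -> itv01 v -> N k.+1 u <> N k.+1 v ->
        separated (gap k) (cell (N k.+1 u)) (cell (N k.+1 v))) /\
      forall k, finite_set (N k @` itv01)].

Lemma exists_branching : exists N, branching N.
Proof.
have /choice[ch chP] : forall ks : nat * node R X, exists C,
    admissible (scale ks.1) ks.2 -> refines mu eps t (scale ks.1)
      (slot_lo ks.2) (slot_hi ks.2) (cell ks.2) C.
  move=> [k s]; have [sadm|nadm] := pselect (admissible (scale k) s).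
    have [C CP] := refine_node eps01 eps_t cX (scale_gt0 k) sadm.
    by exists C.
  by exists set0.
(* The branch of [u] descends to the child whose slot contains [u]. The slots of the children cover
   that of the parent, so the default [root] does not occur for [u] in [[0, 1[]. *)
pose fix N (k : nat) (u : R) {struct k} := if k is k'.+1 then
  xget root (ch (k', N k' u) `&` [set s | slot s u]) else root.
have N_spec k u : itv01 u -> admissible (scale k) (N k u) /\ slot (N k u) u.
  move=> uI; elim: k => [|k [adm us]].
    by split => //; exact: root_admissible.
  have [_ Cprop Ccov _ _] := chP (k, N k u) adm.
  have [s Cs su] := Ccov u us.
  have [Ns Nu] : (ch (k, N k u) `&` [set s | slot s u]) (N k.+1 u).
    by apply: (@xgetI _ _ _ s).
  by split => //; rewrite scaleS; have [] := Cprop _ Ns.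
have N_child k u : itv01 u -> ch (k, N k u) (N k.+1 u).
  move=> uI; have [adm us] := N_spec k u uI.
  have [_ _ Ccov _ _] := chP (k, N k u) adm.
  have [s Cs su] := Ccov u us.
  have [] : (ch (k, N k u) `&` [set s | slot s u]) (N k.+1 u) => //.
  by apply: (@xgetI _ _ _ s).
have N_refines k u : itv01 u -> refines mu eps t (scale k) (slot_lo (N k u))
    (slot_hi (N k u)) (cell (N k u)) (ch (k, N k u)).
  by move=> uI; apply: (chP (k, N k u)); have [] := N_spec k u uI.
exists N; split => //.
- move=> k u uI; have [_ Cprop _ _ _] := N_refines k u uI.
  by have [] := Cprop _ (N_child k u uI).
- move=> k u v uI vI; elim: k => // k IH uv.
  have [_ Cprop _ Cdisj _] := N_refines k u uI.
  (* Slots are nested, so [v] already lies in the slot of [N k u]; disjointness among siblings then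
     settles level [k.+1]. *)
  have NkE : N k v = N k u.
    by apply: IH; have [_ _ _ _] := Cprop _ (N_child k u uI); exact.
  have Cv := N_child k v vI; rewrite NkE in Cv.
  apply: (Cdisj _ _ v Cv (N_child k u uI)) => //.
  by have [] := N_spec k.+1 v vI.
- split; last first.
    elim=> [|k IH].
      apply: (@sub_finite_set _ _ [set root]) => //.
      by move=> _ [u _ <-].
    (* Only the families chosen for admissible nodes are known to be finite, hence the test. *)
    apply: (@sub_finite_set _ _
      (\bigcup_(s in N k @` itv01) (if `[< admissible (scale k) s >]
         then ch (k, s) else set0))).
      move=> _ [u uI <-]; exists (N k u); first by exists u.
      have [adm _] := N_spec k u uI.
      by rewrite asboolT //; exact: N_child.
    apply: bigcup_finite => // s _; case: asboolP => // adm.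
    by have [] := chP (k, s) adm.
  move=> k u v uI vI; elim: k => [|k IH] uv.
    by have [_ _ _ _ Csep] := N_refines 0%N u uI; apply: Csep uv;
      [exact: N_child|exact: (N_child 0%N v vI)].
  have [NkE|Nk_neq] := pselect (N k.+1 u = N k.+1 v).
    have [_ _ _ _ Csep] := N_refines k.+1 u uI; apply: Csep uv.
      exact: N_child.
    by rewrite NkE; exact: N_child.
  (* Cells with distinct parents inherit the larger gap of the parents. *)
  move=> x y x1 y1; apply: le_trans (gap_mono (leqnSn k)) _.
  have sub w : itv01 w -> cell (N k.+2 w) `<=` cell (N k.+1 w).
    move=> wI; have [_ Cprop _ _ _] := N_refines k.+1 w wI.
    by have [] := Cprop _ (N_child k.+1 w wI).
  by apply: (IH Nk_neq); [exact: (sub u uI)|exact: (sub v vI)].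
Qed.

End tree.

(** * The measure and the ultrametric on the limit set *)

(** The uniform law is Lebesgue measure on the closed unit interval; the endpoint 1 escapes the
    inclusion but is a null set. *)
Lemma uniform_prob01_le (R : realType) (A : set R) (a b : R) :
  measurable A -> A `&` `[0, 1[ `<=` `[a, b[ -> a <= b ->
  (uniform_prob (@ltr01 R) A <= (b - a)%:E)%E.
Proof.
move=> mA Aab ab.
have mA01 : measurable (A `&` `[0, 1]) by exact: measurableI.
have mab : measurable (`[a, b[ `|` [set 1] : set R) by exact: measurableU.
have -> : uniform_prob (@ltr01 R) A = lebesgue_measure (A `&` `[0, 1]).
  rewrite /uniform_prob integral_uniform_pdf.
  rewrite (eq_integral (cst 1%E)).
    by rewrite integral_cst // mul1e.
  move=> x; rewrite inE /= => -[_]; rewrite in_itv /= => x01.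
  by rewrite /uniform_pdf x01 subr0 invr1.
apply: (@le_trans _ _ (lebesgue_measure (`[a, b[ `|` [set 1] : set R))).
  apply: le_measure; rewrite ?inE // => x [Ax].
  rewrite /= in_itv /= => /andP[x0]; rewrite le_eqVlt => /predU1P[->|x1].
    by right.
  by left; apply: Aab; split => //=; rewrite in_itv /= x0.
apply: le_trans (measureU2 _ _ _) _ => //.
rewrite [X in (_ + X)%E]lebesgue_measure_set1 adde0.
rewrite [leLHS]lebesgue_measure_itv /= lte_fin.
by case: ifPn => // _; rewrite lee_fin subr_ge0.
Qed.

Section skeleton.
Context {R : realType} {X : pointedMetricType R}.
Variables (mu : probability (borel X) R) (eps : R) (t : nat).
Hypothesis eps01 : 0 < eps < 1.
Hypothesis eps_t : 1 <= eps * t%:R.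
Hypothesis cX : compact [set: X].
Variable Delta : R.
Hypothesis Delta_gt0 : 0 < Delta.
Hypothesis diamX : forall x y : X, mdist x y <= Delta.

Local Notation itv01 := (`[0, 1[%classic : set R).
Local Notation scale := (scale Delta).
Local Notation gap := (gap t Delta).
Local Notation mass := (mass mu).

Variable N : nat -> R -> node R X.
Hypothesis NP : branching mu eps t Delta N.

Definition skeleton : set X :=
  [set x | forall k, exists2 u, itv01 u & cell (N k u) x].

(** [uniform_prob] lives on all of [R] and charges the closed interval, the
    slots only fill [0, 1[. *)
Definition clamp (u : R) : R := if 0 <= u < 1 then u else 0.

(** The cells along a branch shrink to exactly one point, so the default [point] does not occur. The
    image of the uniform law under this map is the measure sought. *)
Definition branch_point (u : R) : borel X :=
  xget (point : X) [set x : X | forall k, cell (N k (clamp u)) x].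

Let I_clamp u : itv01 (clamp u).
Proof.
rewrite /= in_itv /= /clamp; case: ifPn => // _.
by rewrite lexx ltr01.
Qed.

Let clamp_id u : itv01 u -> clamp u = u.
Proof. by rewrite /= in_itv /= /clamp => ->. Qed.

Let N_adm k u : itv01 u -> admissible mu eps (scale k) (N k u).
Proof. by case: NP => _ + _ _ _ uI => /(_ k u uI)[]. Qed.

Let N_slot k u : itv01 u -> slot (N k u) u.
Proof. by case: NP => _ + _ _ _ uI => /(_ k u uI)[]. Qed.

Let N_sub k u : itv01 u -> cell (N k.+1 u) `<=` cell (N k u).
Proof. by case: NP => _ _ + _ _ uI => /(_ k u uI)[]. Qed.

Let cell_closed k u : itv01 u -> closed (cell (N k u)).
Proof. by move=> /(N_adm k)[]. Qed.

Let cell_nonempty k u : itv01 u -> cell (N k u) !=set0.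
Proof.
move=> /(N_adm k)[_ m0 _ _]; apply/set0P/eqP => cell0.
by move: m0; rewrite cell0 /mass measure0 ltxx.
Qed.

Let N_thin k u x y : itv01 u -> cell (N k u) x -> cell (N k u) y ->
  mdist x y <= scale k.
Proof.
case: k => [|k] uI xu yu; first by rewrite /scale expr0 divr1.
by rewrite scaleS; case: NP => _ _ + _ _ => /(_ k u uI)[_ + _]; exact.
Qed.

Let N_sep k u v : itv01 u -> itv01 v -> N k.+1 u <> N k.+1 v ->
  separated (gap k) (cell (N k.+1 u)) (cell (N k.+1 v)).
Proof. by case: NP => _ _ _ _ [+ _]; exact. Qed.

(** Below the root, distinct cells of one level are a positive gap apart. *)
Let same_cell k u v x : itv01 u -> itv01 v ->
  cell (N k u) x -> cell (N k v) x -> N k u = N k v.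
Proof.
case: k => [|k] uI vI xu xv; first by case: NP => N0 _ _ _ _; rewrite !N0.
apply: contrapT => uv; have := N_sep uI vI uv xu xv.
by rewrite mdistxx leNgt (gap_gt0 eps_t).
Qed.

Let scale_lt e : 0 < e -> exists k, scale k < e.
Proof. exact: exists_geometric_lt. Qed.

Let eq_thin (x y : X) : (forall k, mdist x y <= scale k) -> x = y.
Proof.
move=> xy; apply: mdist_positivity; apply/eqP; rewrite eq_le mdist_ge0 andbT.
apply/ler_addgt0Pl => e /scale_lt[k ke]; rewrite addr0.
exact: le_trans (xy k) (ltW ke).
Qed.

Lemma branch_pointP u k : cell (N k (clamp u)) (branch_point u).
Proof.
have [x xP] : exists x : X, forall k, cell (N k (clamp u)) x.
  by apply: nested_closed_nonempty => // n; [exact: cell_closed|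
    exact: cell_nonempty|exact: N_sub].
by apply: (@xgetI _ _ [set x : X | forall k, cell (N k (clamp u)) x] x).
Qed.

Lemma branch_point_uniq u x : (forall k, cell (N k (clamp u)) x) ->
  x = branch_point u.
Proof.
move=> xP; apply: eq_thin => k; apply: N_thin (xP k) _ => //.
exact: branch_pointP.
Qed.

(** On [[0, 1[] the node is constant on each of the finitely many slots of level [k], which gives a
    finite union of slots. Elsewhere [clamp] is 0 and the condition is constant. *)
Lemma measurable_node_pred (k : nat) (P : node R X -> Prop) :
  measurable [set u | P (N k (clamp u))].
Proof.
have -> : [set u | P (N k (clamp u))] =
    (itv01 `&` \bigcup_(s in N k @` itv01 `&` P) slot s) `|`
    (~` itv01 `&` [set _ | P (N k 0)]).
  apply/seteqP; split => u /=.
    have [uI|nuI] := pselect (itv01 u).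
      rewrite clamp_id // => Pu; left; split => //; exists (N k u).
        by split => //; exists u.
      exact: N_slot.
    by rewrite /clamp; case: ifPn => [uI|_ P0]; [|right; split].
  move=> [[uI [s [[v vI <-] Ps] us]]|[nuI P0]].
    by rewrite clamp_id //; case: NP => _ _ _ /(_ k v u vI uI us) -> _.
  by rewrite /clamp; case: ifPn.
have mI : measurable itv01 by exact: measurable_itv.
apply: measurableU; apply: measurableI => //.
- apply: fin_bigcup_measurable => [|s _]; last exact: measurable_itv.
  by apply: finite_setIl; case: NP => _ _ _ _ [].
- exact: measurableC.
- have [P0|nP0] := pselect (P (N k 0)).
    by rewrite (_ : [set _ | _] = setT) //; apply/seteqP; split.
  by rewrite (_ : [set _ | _] = set0) //; apply/seteqP; split.
Qed.

(** By compactness, [branch_point u] avoids an open set if and only if every cell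
    of the branch meets its complement. *)
Lemma measurable_branch_point :
  @measurable_fun _ _ (measurableTypeR R) (borel X) setT branch_point.
Proof.
apply: (@measurability _ _ _ (borel X) setT branch_point (@open X)) => //.
move=> _ [V oV <-].
rewrite setTI -[X in measurable X]setCK; apply: measurableC.
rewrite (_ : ~` _ = \bigcap_k
    [set u | exists2 x, cell (N k (clamp u)) x & ~ V x]).
  apply: bigcapT_measurable => k.
  exact: (measurable_node_pred k (fun s => exists2 x, cell s x & ~ V x)).
apply/seteqP; split => u /=.
  by move=> nV k _; exists (branch_point u) => //; exact: branch_pointP.
move=> H nV.
have [x xP] : exists x : X, forall k, (cell (N k (clamp u)) `&` ~` V) x.
  apply: nested_closed_nonempty => // k.
  - by apply: closedI; [exact: cell_closed|exact: open_closedC].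
  - by have [x xu nVx] := H k I; exists x.
  - by apply: setSI; exact: N_sub.
have [_] := xP 0%N; rewrite (@branch_point_uniq u x) => [|k]; first exact.
by have [] := xP k.
Qed.

Definition skeleton_prob : probability (borel X) R :=
  distribution (uniform_prob (@ltr01 R))
    (@mfun_Sub _ _ (measurableTypeR R) (borel X) branch_point
      (mem_set measurable_branch_point)).

(** Each level has finitely many cells, all closed. *)
Lemma skeleton_closed : closed skeleton.
Proof.
have -> : skeleton = \bigcap_k \bigcup_(s in N k @` itv01) cell s.
  apply/seteqP; split => x.
    by move=> xS k _; have [u uI xu] := xS k; exists (N k u) => //; exists u.
  by move=> xS k; have [s [u uI <-] xu] := xS k I; exists u.
apply: closed_bigI => k _; apply: closed_bigcup => [|s [u uI <-]].
  by case: NP => _ _ _ _ [].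
exact: cell_closed.
Qed.

Lemma skeleton_probT : skeleton_prob skeleton = 1%E.
Proof.
rewrite -(probability_setT (uniform_prob (@ltr01 R))).
rewrite /skeleton_prob /distribution /= /pushforward; congr (uniform_prob _ _).
apply/seteqP; split => // u _ k; exists (clamp u) => //.
exact: branch_pointP.
Qed.

(** Points that part after level [k] share a cell of diameter at most [scale k] and lie in distinct
    cells of level [k.+1], at least [gap k] apart. The distortion is the ratio of [scale k] to
    [gap k]. *)
Lemma skeleton_embeds : embeds_ultrametric skeleton (16 * t%:R).
Proof.
(* The disjunct [x = y] makes [E k] an equivalence on all of [X], so that the
   ultrametric need not be restricted to the skeleton. *)
pose E k (x y : X) :=
  x = y \/ exists2 u, itv01 u & cell (N k u) x /\ cell (N k u) y.
have I0 : itv01 0 by rewrite /= in_itv /= lexx ltr01.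
have E_thin k x y : E k x y -> mdist x y <= scale k.
  case=> [->|[u uI [xu yu]]]; last exact: N_thin yu.
  by rewrite mdistxx ltW // scale_gt0.
have [|||||||||U [f [ultU finj fE]]] :=
    @exists_ultrametric_of_tree R X scale E.
- exact: scale_gt0.
- exact: scale_mono.
- exact: scale_lt.
- by move=> x y; right; exists 0 => //; case: NP => N0 _ _ _ _; rewrite N0.
- by move=> k x; left.
- by move=> k x y [->|[u uI [xu yu]]]; [left|right; exists u].
- move=> k x y z [->//|[u uI [xu yu]]] [<-|[v vI [yv zv]]].
    by right; exists u.
  by right; exists u => //; rewrite {2}(same_cell uI vI yu yv).
- move=> k x y [->|[u uI [xu yu]]]; first by left.
  by right; exists u => //; split; exact: N_sub.
- by move=> x y xy; apply: eq_thin => k; exact: E_thin.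
split.
  have t1 : 1 <= t%:R :> R by rewrite ler1n -(ltr0n R) (t_gt0 eps_t).
  lra.
exists U, f; split => // [x y _ _|x y]; first exact: finj.
rewrite !inE => xS yS; have [->|/fE[k [Ekxy nE ->]]] := pselect (x = y).
  by rewrite !mdistxx mulr0 lexx.
rewrite E_thin //=.
have [u uI xu] := xS k.+1; have [v vI yv] := yS k.+1.
have gap_le : gap k <= mdist x y.
  apply: (N_sep uI vI _ xu yv) => uv; apply: nE; right.
  by exists u; [exact: uI|rewrite {2}uv].
by rewrite mulrC -ler_pdivrMr ?mulr_gt0 ?(t_gt0 eps_t).
Qed.

(** The branch points in so small a ball all lie in one cell of level [k.+1]. Its weight bounds the
    measure of the ball, and [capped] bounds that weight. *)
Lemma skeleton_prob_small x r k : 2 * r < gap k ->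
  (skeleton_prob (cball x r) <=
    (mass (cball x (r + scale k / 4)) `^ (1 - eps))%:E)%E.
Proof.
have [_ e1] := andP eps01.
move=> r_gap; have [[u ux]|H] := pselect (exists u, cball x r (branch_point u)).
  have bu := branch_pointP u k.+1.
  have slot_u : slot (N k.+1 (clamp u)) (clamp u) by exact: N_slot.
  apply: (@le_trans _ _ (weight (N k.+1 (clamp u)))%:E).
    apply: uniform_prob01_le.
    - rewrite -[X in measurable X]setTI; apply: measurable_branch_point => //.
      exact: cball_borel.
    (* Two branch points in the ball are at distance at most [2 * r], less than the gap between
       distinct cells. *)
    - move=> v [vx vI]; suff -> : N k.+1 (clamp u) = N k.+1 v by exact: N_slot.
      apply: contrapT => uv.
      have bv := branch_pointP v k.+1; rewrite (clamp_id vI) in bv.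
      have := N_sep (I_clamp u) vI uv bu bv.
      have := metric_triangle (branch_point u : X) x (branch_point v).
      rewrite (metric_sym x); move: ux vx; rewrite /cball /=; lra.
    - exact: ltW (le_lt_trans (slot_ge_lo slot_u) (slot_lt_hi slot_u)).
  rewrite lee_fin.
  have [cap _ _] : [/\ capped mu eps (scale k) (N k.+1 (clamp u)),
      thin (scale k) (N k.+1 (clamp u)) &
      cell (N k.+1 (clamp u)) `<=` cell (N k (clamp u))].
    by case: NP => _ _ + _ _; exact.
  apply: le_trans (cap _ bu) _; apply: ge0_ler_powR.
  - by rewrite subr_ge0 ltW.
  - by rewrite nnegrE mass_ge0.
  - by rewrite nnegrE mass_ge0.
  apply: mass_le; [exact: cball_borel..|] => y; rewrite /cball /= => yu.
  have := metric_triangle y (branch_point u : X) x.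
  by move: ux; rewrite /cball /=; lra.
rewrite (_ : skeleton_prob _ = 0%E) ?lee_fin ?powR_ge0 //.
rewrite /skeleton_prob /distribution /= /pushforward.
rewrite (_ : _ @^-1` _ = set0) ?measure0 //.
by apply/seteqP; split => // u ux; apply: H; exists u.
Qed.

(** With [gap k.+1 <= 2 * r < gap k], the enlarged radius is
    [r + scale k.+1 = r + 16 * t * gap k.+1], at most [r + 32 * t * r], which is below
    [64 * t * r]. *)
Lemma skeleton_prob_cball x r : 0 < r ->
  (skeleton_prob (cball x r) <=
    (mass (cball x (64 * t%:R * r)) `^ (1 - eps))%:E)%E.
Proof.
move=> r0; have t0 := t_gt0 eps_t; have [_ e1] := andP eps01.
have scaleE k : scale k = 16 * t%:R * gap k.
  by rewrite mulrC divfK // gt_eqF // mulr_gt0.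
(* Once [2 * r] reaches [gap 0], the larger ball has radius at least [Delta] and is the whole
   space. *)
have [gap_le|gap_gt] := leP (gap 0) (2 * r).
  rewrite (_ : cball x (64 * _ * r) = setT) ?massT ?powR1.
    by apply: probability_le1; exact: cball_borel.
  apply/seteqP; split => // y _; rewrite /cball /=.
  apply: le_trans (diamX _ _) _.
  have -> : Delta = 16 * t%:R * gap 0 by rewrite -scaleE /scale expr0 divr1.
  have -> : 64 * t%:R * r = 16 * t%:R * (4 * r) by ring.
  by rewrite ler_pM2l ?mulr_gt0 //; lra.
have [n gap_n] : exists n, gap n <= 2 * r.
  have [|n nP] := @exists_geometric_lt R Delta (16 * t%:R * (2 * r)).
    by rewrite !mulr_gt0.
  by exists n; rewrite /gap ler_pdivrMr ?mulr_gt0 // mulrC ltW.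
(* The least level with gap at most [2 * r]; it is not 0 here, so it has a predecessor [k]. *)
have [[|k] k_le k_min] := ex_minnP (ex_intro (fun n => gap n <= 2 * r) n gap_n).
  by rewrite leNgt gap_gt in k_le.
have gap_k : 2 * r < gap k by rewrite ltNge; apply/negP => /k_min; rewrite ltnn.
apply: le_trans (skeleton_prob_small x gap_k) _; rewrite lee_fin.
apply: ge0_ler_powR.
- by rewrite subr_ge0 ltW.
- by rewrite nnegrE mass_ge0.
- by rewrite nnegrE mass_ge0.
apply: mass_le; [exact: cball_borel..|] => y; rewrite /cball /=.
move=> /le_trans; apply.
rewrite -scaleS scaleE.
have : 16 * t%:R * gap k.+1 <= 16 * t%:R * (2 * r).
  by rewrite ler_pM2l ?mulr_gt0.
have : r <= t%:R * r by rewrite ler_peMl ?(ltW r0) // ler1n -(ltr0n R).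
lra.
Qed.

End skeleton.

(** * Radius zero and choice of the constants *)

Lemma compact_diameter (R : realType) (X : pointedMetricType R) :
  compact [set: X] -> exists2 D : R, 0 < D & forall x y : X, mdist x y <= D.
Proof.
move=> cX; have [s s_cov] := compact_net cX ltr01.
have s0 : s != [::].
  by apply/eqP => s0; have [z] := s_cov point; rewrite s0.
have [z _ zmax] := exists_max_seq (fun y => mdist y point) s0.
have near_point (x : X) : mdist x point <= 1 + mdist z point.
  have [y ys xy] := s_cov x; have := metric_triangle x y point.
  by have := zmax y ys; lra.
exists (2 * (1 + mdist z point)).
  by have := mdist_ge0 z point; lra.
move=> x y; have := metric_triangle x point y; rewrite (metric_sym point).
by have := near_point x; have := near_point y; lra.
Qed.

Lemma embeds_ultrametric_le (R : realType) (X : metricType R) (S : set X)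
    (D D' : R) :
  D <= D' -> embeds_ultrametric S D -> embeds_ultrametric S D'.
Proof.
move=> DD' [D1 [U [f [ultU finj fE]]]]; split; first exact: le_trans DD'.
exists U, f; split => // x y xS yS; have /andP[-> fD] := fE x y xS yS.
by apply: le_trans fD _; rewrite ler_wpM2r // mdist_ge0.
Qed.

(** Continuity of [mu] from above along the radii [C / (n + 1)]. This serves the radius 0, for which
    no level has a gap comparable to it. *)
Lemma cball0_limit (R : realType) (X : pointedMetricType R)
    (mu : probability (borel X) R) (x : X) (a C : R) : 0 < C ->
  (forall r, 0 < r -> a <= mass mu (cball x (C * r))) ->
  a <= mass mu (cball x 0).
Proof.
move=> C0 aC; pose F n := cball x (C * n.+1%:R^-1) : set (borel X).
have FE : \bigcap_n F n = cball x 0.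
  apply/seteqP; split => y; rewrite /F /cball /=.
    move=> yF; rewrite leNgt; apply/negP => yx.
    have Cy : 0 <= C / mdist y x by rewrite divr_ge0 // ltW.
    have := yF (Num.bound (C / mdist y x)) I; rewrite /= leNgt => /negP; apply.
    rewrite ltr_pdivrMr // -ltr_pdivrMl // mulrC.
    by apply: lt_trans (archi_boundP Cy) _; rewrite ltr_nat.
  move=> y0 n _; apply: le_trans y0 _.
  by rewrite mulr_ge0 ?invr_ge0 // ltW.
have mF n : measurable (F n) by exact: cball_borel.
have Fcvg : mu \o F @ \oo --> mu (\bigcap_n F n).
  apply: nonincreasing_cvg_mu => //.
  - by rewrite ltey_eq fin_num_measure.
  - exact: bigcapT_measurable.
  - move=> m n mn; apply/subsetPset => y /le_trans; apply.
    by rewrite ler_pM2l // lef_pV2 ?posrE // ler_nat.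
rewrite -lee_fin -massE; last exact: cball_borel.
rewrite -FE -(cvg_lim _ Fcvg) //; apply: lime_ge.
  by apply/cvg_ex; exists (mu (\bigcap_n F n)).
by apply: nearW => n; rewrite /= massE // lee_fin aC.
Qed.

(** Moves the exponent to the constant side, so that the limit is taken of masses and not of their
    powers. *)
Lemma le_powR_inv (R : realType) (a b p : R) : 0 < p -> 0 <= a -> 0 <= b ->
  (a <= b `^ p) = (a `^ p^-1 <= b).
Proof.
move=> p0 a0 b0; have p_neq0 := lt0r_neq0 p0.
have ip0 : 0 <= p^-1 by rewrite invr_ge0 ltW.
apply/idP/idP => ab.
- rewrite -[leRHS]powRr1 // -(mulfV p_neq0) powRrM.
  by apply: ge0_ler_powR; rewrite ?nnegrE ?powR_ge0.
- rewrite -[leLHS]powRr1 // -(mulVf p_neq0) powRrM.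
  by apply: ge0_ler_powR; rewrite ?nnegrE ?powR_ge0 ?(ltW p0).
Qed.

Theorem theorem1p1 (R : realType) :
  exists K : R, 0 < K /\
  forall eps : R, 0 < eps < 1 ->
  exists C : R, 0 < C /\
  forall (X : pointedMetricType R) (mu : probability (borel X) R),
    compact [set: X] ->
  exists S : set X,
    [/\ compact S,
        embeds_ultrametric S (K / eps) &
        exists nu : probability (borel X) R,
          nu S = 1%E /\
          forall (x : X) (r : R), 0 <= r ->
            (nu (cball x r) <= mu (cball x (C * r)) `^ (1 - eps))%E].
Proof.
(* The distortion is [16 * t], and [t] is chosen at most [2 / eps]. *)
exists 32; split => // eps eps01; have [e0 e1] := andP eps01.
have ie1 : 1 <= eps^-1 by rewrite invf_ge1 // ltW.
(* Rounding up adds at most 1, which is at most [eps^-1]. *)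
have [t t_ge t_le] : exists2 t : nat, eps^-1 <= t%:R & t%:R <= 2 * eps^-1.
  have /andP[lo hi] := truncn_itv (le_trans ler01 ie1).
  by exists (Num.trunc eps^-1).+1; [exact: ltW|rewrite -natr1; lra].
have eps_t : 1 <= eps * t%:R by rewrite -ler_pdivrMl // mulr1.
have t0 : 0 < t%:R :> R by exact: lt_le_trans (lt_le_trans ltr01 ie1) t_ge.
exists (64 * t%:R); split; first exact: mulr_gt0.
move=> X mu cX; have [Delta Delta0 diamX] := compact_diameter cX.
have [N NP] := exists_branching mu eps01 eps_t cX Delta0.
exists (skeleton N); split.
- exact: subclosed_compact (skeleton_closed NP) cX (@subsetT _ _).
- apply: embeds_ultrametric_le (skeleton_embeds eps_t Delta0 diamX NP).
  by rewrite -ler_pdivlMl //; lra.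
exists (skeleton_prob cX diamX NP); split.
  exact: skeleton_probT.
move=> x r; have mB := cball_borel x.
rewrite (massE mu (mB _)) poweR_EFin le_eqVlt => /predU1P[<-|r0]; last first.
  exact: skeleton_prob_cball.
set nu := skeleton_prob _ _ _.
have p0 : 0 < 1 - eps by rewrite subr_gt0.
(* At radius 0, the ball lies in each ball of radius [r' > 0], where the bound is known; then [r']
   tends to 0. *)
rewrite mulr0 (massE nu (mB _)) lee_fin le_powR_inv ?mass_ge0 //.
apply: (@cball0_limit _ _ _ _ _ (64 * t%:R)); first exact: mulr_gt0.
move=> r' r'0; rewrite -le_powR_inv ?mass_ge0 // -lee_fin -(massE nu (mB _)).
apply: le_trans (skeleton_prob_cball eps01 eps_t cX diamX NP x r'0).
apply: le_measure; rewrite ?inE; [exact: mB..|].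
by move=> y; rewrite /cball /= => /le_trans; apply; exact: ltW.
Qed.
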